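(* Consider the stochastic Hamiltonian system described in the context with a nonconservative force $u_t\in C^1(S\times\mathbb{R}^n,\mathbb{R}^n)$, and let $F\in C^\infty(S,\mathbb{P}_n)$ be given. At any time $t\geq0$, consider the problem of minimising $$\frac{\mathrm{d}}{\mathrm{d}t}\mathbf{E}H(X_t)+\frac12\mathbf{E}\big(\|u_t(X_t)\|_{F(Q_t)^{-1}}^2\big)\longrightarrow\inf$$ over the force $u_t$ at that time (pointwise in time, for the given distribution of $X_t$). Then, at any time $t\geq0$, the optimal force is delivered by the time-invariant law $$u_t(x)=-F(q)\dot q,\qquad q\in S,\ p\in\mathbb{R}^n,$$ where $x=(q,p)$ and $\dot q:=M(q)^{-1}p$ is the velocity vector.
   Context: Position space: $S$ is $\mathbb{R}^n$, $\mathbb{T}^n$ or, more generally, $\mathbb{R}^{n-r}\times\mathbb{T}^r$, with $\mathbb{T}=\mathbb{R}/(2\pi\mathbb{Z})$ (functions on $\mathbb{T}$ are $2\pi$-periodic functions on $\mathbb{R}$). $\mathbb{P}_n$ is the set of real symmetric positive definite matrices of order $n$; $\|v\|_N:=\sqrt{v^{\mathrm T}Nv}$ for $N\succ0$; $\langle K,N\rangle_{\mathrm F}:=\mathrm{Tr}(K^{\mathrm T}N)$; $\partial_q,\partial_p$ are gradients over $q$ and $p$; $\partial_p^2$ is the Hessian matrix over $p$; $\mathbf{E}$ is expectation. System: $V\in C^\infty(S,\mathbb{R}_+)$, $M,G\in C^\infty(S,\mathbb{P}_n)$, and $H(x):=V(q)+\frac12\|p\|_{M(q)^{-1}}^2$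 for $x=(q,p)\in S\times\mathbb{R}^n$. The state $X_t=(Q_t,P_t)$ is a diffusion process in $S\times\mathbb{R}^n$ governed by $$\dot Q_t=\partial_pH(X_t)=M(Q_t)^{-1}P_t,\qquad \mathrm{d}P_t=\big(-\partial_qH(X_t)+u_t(X_t)\big)\mathrm{d}t+\sqrt{G(Q_t)}\,\mathrm{d}W_t,$$ where $W$ is a standard Wiener process in $\mathbb{R}^n$ independent of $X_0$. Its infinitesimal generator at time $t$ acts on $\varphi\in C^2(S\times\mathbb{R}^n,\mathbb{R})$ as $\mathcal{L}_t(\varphi)=\{\varphi,H\}+u_t^{\mathrm T}\partial_p\varphi+\frac12\langle G,\partial_p^2\varphi\rangle_{\mathrm F}$, with $\{\varphi,\psi\}:=\partial_q\varphi^{\mathrm T}\partial_p\psi-\partial_p\varphi^{\mathrm T}\partial_q\psi$. The rate $\frac{\mathrm{d}}{\mathrm{d}t}\mathbf{E}H(X_t)$ is understood as $\mathbf{E}\,\mathcal{L}_t(H)(X_t)$, and the expectations involved are assumed to be finite. *)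

(* Defs.v *)
From mathcomp Require Import all_boot all_order all_algebra.
From mathcomp Require Import all_classical all_reals all_analysis.

Set Implicit Arguments.
Unset Strict Implicit.
Unset Printing Implicit Defensive.

Import Order.TTheory GRing.Theory Num.Theory.
Import numFieldNormedType.Exports.

Local Open Scope classical_set_scope.
Local Open Scope ring_scope.

Section smoothness.
Context {R : realType}.

(* On a finite-dimensional [U] this is the usual class C^k (all partial
   derivatives up to order k exist and are continuous). *)
Fixpoint Ck (k : nat) {U W : normedModType R} (f : U -> W) : Prop :=
  if k is k'.+1 then
    (forall x, differentiable f x) /\ (forall v, Ck k' (fun x => 'D_v f x))
  else continuous f.

Definition Cinfty {U W : normedModType R} (f : U -> W) : Prop :=
  forall k, Ck k f.

End smoothness.

Section matrices.
Context {R : realType} {n : nat}.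

Definition posdef (A : 'M[R]_n) : Prop :=
  A^T = A /\ forall v : 'cV[R]_n, v != 0 -> 0 < (v^T *m A *m v) 0 0.

Definition wnorm (N : 'M[R]_n) (v : 'cV[R]_n) : R :=
  Num.sqrt ((v^T *m N *m v) 0 0).

Definition frob (K N : 'M[R]_n) : R := \tr (K^T *m N).

(* The principal square root: for a positive definite [A] there is exactly one
   positive definite [B] with [B *m B = A]. *)
Definition sqrtm (A : 'M[R]_n) : 'M[R]_n :=
  xget 0 [set B : 'M[R]_n | posdef B /\ B *m B = A].

End matrices.

(* The position space S = R^(n-r) x T^r, T = R/(2 pi Z), is handled through its
   covering space R^n: a function on S is a function on R^n which is
   2 pi-periodic in each of the last r coordinates, and a point of the phase
   space S x R^n is represented by a pair (q, p) in R^n x R^n. *)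
Definition phase (R : realType) (n : nat) : normedModType R :=
  ('cV[R]_n * 'cV[R]_n)%type.

Section position_space.
Context {R : realType} {n : nat}.

Definition on_position {W : Type} (r : nat) (f : 'cV[R]_n -> W) : Prop :=
  forall (q : 'cV[R]_n) (i : 'I_n), (n - r <= i)%N ->
    f (q + (2 * pi) *: delta_mx i 0) = f q.

Definition on_phase {W : Type} (r : nat) (f : phase R n -> W) : Prop :=
  forall p : 'cV[R]_n, on_position r (fun q => f (q, p)).

Definition smooth_spd (r : nat) (A : 'cV[R]_n -> 'M[R]_n) : Prop :=
  [/\ on_position r A, Cinfty A & forall q, posdef (A q)].

Definition smooth_potential (r : nat) (V : 'cV[R]_n -> R) : Prop :=
  [/\ on_position r V, Cinfty V & forall q, 0 <= V q].

(* C^1(S x R^n, R^n) *)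
Definition force (r : nat) (v : phase R n -> 'cV[R]_n) : Prop :=
  on_phase r v /\ Ck 1 v.

End position_space.

Section hamiltonian.
Context {R : realType} {n : nat}.
Implicit Types (x : phase R n) (phi psi : phase R n -> R).

Definition grad_q phi x : 'cV[R]_n :=
  \col_i 'D_(delta_mx i 0 : 'cV[R]_n) (fun q => phi (q, x.2)) x.1.

Definition grad_p phi x : 'cV[R]_n :=
  \col_i 'D_(delta_mx i 0 : 'cV[R]_n) (fun p => phi (x.1, p)) x.2.

Definition hess_p phi x : 'M[R]_n :=
  \matrix_(i, j) 'D_(delta_mx i 0 : 'cV[R]_n)
    (fun p => grad_p phi (x.1, p) j 0) x.2.

Definition poisson phi psi x : R :=
  ((grad_q phi x)^T *m grad_p psi x - (grad_p phi x)^T *m grad_q psi x) 0 0.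

Definition hamiltonian (V : 'cV[R]_n -> R) (M : 'cV[R]_n -> 'M[R]_n) x : R :=
  V x.1 + 2^-1 * wnorm (invmx (M x.1)) x.2 ^+ 2.

Definition velocity (M : 'cV[R]_n -> 'M[R]_n) x : 'cV[R]_n :=
  invmx (M x.1) *m x.2.

(* The infinitesimal generator under the Hamiltonian [H], the diffusion matrix
   [G] and the instantaneous force [v]. *)
Definition generator H (G : 'cV[R]_n -> 'M[R]_n) (v : phase R n -> 'cV[R]_n)
    phi x : R :=
  poisson phi H x + ((v x)^T *m grad_p phi x) 0 0
  + 2^-1 * frob (G x.1) (hess_p phi x).

End hamiltonian.

Section stochastics.
Context {R : realType} {d : measure_display} {Omega : measurableType d}.
Variable P : probability Omega R.
Context {n : nat}.

(* Time is the half-line [0, +oo[ : processes are indexed by R, but only their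
   values at nonnegative times are ever constrained or used. *)
Definition filtration (FF : R -> set (set Omega)) : Prop :=
  (forall t, 0 <= t -> sigma_algebra setT (FF t) /\ FF t `<=` measurable) /\
  (forall s t, 0 <= s -> s <= t -> FF s `<=` FF t).

Definition adapted (FF : R -> set (set Omega))
    (Y : R -> Omega -> 'cV[R]_n) : Prop :=
  forall t, 0 <= t -> forall (i : 'I_n) (B : set R), measurable B ->
    FF t ((fun w => Y t w i 0) @^-1` B).

(* Standard Wiener process relative to [FF].  The product formula says at once
   that the increment over [s, t] is independent of [FF s] and has independent
   N(0, t - s) coordinates; in particular W is independent of any
   [FF 0]-measurable initial state. *)
Definition wiener (FF : R -> set (set Omega))
    (W : R -> Omega -> 'cV[R]_n) : Prop :=
  [/\ adapted FF W,
      {ae P, forall w, W 0 w = 0},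
      {ae P, forall w, {within `[0, +oo[, continuous (fun t => W t w)}} &
      forall s t, 0 <= s -> s < t ->
      forall A, FF s A -> forall B : 'I_n -> set R,
        (forall i, measurable (B i)) ->
        P (A `&` [set w | forall i, B i (W t w i 0 - W s w i 0)]) =
        (P A * \prod_(i < n) normal_prob 0 (Num.sqrt (t - s)) (B i))%E].

(* [Z t] is the Ito integral of [K] against [W] over [0, t].  For an integrand
   with continuous adapted paths it is the limit in probability of the
   left-point Riemann sums. *)
Definition ito_integral (K : R -> Omega -> 'M[R]_n)
    (W Z : R -> Omega -> 'cV[R]_n) : Prop :=
  forall t, 0 <= t -> forall e : R, 0 < e ->
    (fun N : nat => P [set w | e <
       `| \sum_(k < N) K (t * k%:R / N%:R) w *m
            (W (t * k.+1%:R / N%:R) w - W (t * k%:R / N%:R) w) - Z t w |])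
      @ \oo --> 0%E.

(* X = (Q, P) solves
     dQ = d_p H(X) dt,  dP = (- d_q H(X) + u_t(X)) dt + sqrt(G(Q)) dW.
   On a torus, Q stands for a continuous adapted lift of the position process
   to the covering space. *)
Definition sde_solution (H : phase R n -> R) (G : 'cV[R]_n -> 'M[R]_n)
    (u : R -> phase R n -> 'cV[R]_n) (FF : R -> set (set Omega))
    (W : R -> Omega -> 'cV[R]_n) (X : R -> Omega -> phase R n) : Prop :=
  let drift (s : R) (w : Omega) : 'cV[R]_n :=
    - grad_q H (X s w) + u s (X s w) in
  [/\ adapted FF (fun t w => (X t w).1) /\ adapted FF (fun t w => (X t w).2),
      {ae P, forall w, {within `[0, +oo[, continuous (fun t => X t w)}},
      {ae P, forall w, forall t : R, 0 < t ->
         is_derive t 1 (fun s => (X s w).1) (grad_p H (X t w))},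
      {ae P, forall w, forall t, 0 <= t -> forall i,
         (@lebesgue_measure R).-integrable `[0, t]
           (fun s => (drift s w i 0)%:E)} &
      exists Z : R -> Omega -> 'cV[R]_n,
        [/\ adapted FF Z,
            ito_integral (fun t w => sqrtm (G (X t w).1)) W Z &
            {ae P, forall w, forall t, 0 <= t ->
               (X t w).2 = (X 0 w).2
                 + \col_i Rintegral (@lebesgue_measure R) `[0, t]
                                    (fun s => drift s w i 0)
                 + Z t w}]].

Section cost.
Variables (V : 'cV[R]_n -> R) (M G F : 'cV[R]_n -> 'M[R]_n).
(* the state at a fixed time, and the force applied at that time *)
Variables (Xt : Omega -> phase R n) (v : phase R n -> 'cV[R]_n).

Let H := hamiltonian V M.

Definition power (w : Omega) : R := generator H G v H (Xt w).

Definition effort (w : Omega) : R :=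
  wnorm (invmx (F (Xt w).1)) (v (Xt w)) ^+ 2.

(* d/dt E H(X_t), understood as E L_t(H)(X_t) *)
Definition energy_rate : \bar R := 'E_P[power].

Definition cost : \bar R := (energy_rate + (2^-1)%:E * 'E_P[effort])%E.

Definition finite_expectations : Prop :=
  P.-integrable setT (EFin \o power) /\ P.-integrable setT (EFin \o effort).

End cost.

Definition admissible (r : nat) V M G F Xt v : Prop :=
  force r v /\ finite_expectations V M G F Xt v.

Definition optimal_force (r : nat) V M G F Xt v : Prop :=
  admissible r V M G F Xt v /\
  forall v', admissible r V M G F Xt v' ->
    (cost V M G F Xt v <= cost V M G F Xt v')%E.

End stochastics.

(* Main.v *)
Require Import Defs.
From mathcomp Require Import all_boot all_order all_algebra.
From mathcomp Require Import all_classical all_reals all_analysis.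
From mathcomp Require Import ring.
Import Order.TTheory GRing.Theory Num.Theory.
Import numFieldNormedType.Exports.
Local Open Scope classical_set_scope.
Local Open Scope ring_scope.

Set Implicit Arguments.
Unset Strict Implicit.
Unset Printing Implicit Defensive.

(** The theorem is a completion of the square inside the expectation.  The
    Poisson bracket of H with itself vanishes and the momentum gradient of H is
    the velocity y = M^-1 p, so the generator applied to H is v^T y plus a term
    which does not involve the force v.  For a positive definite F,

      v^T y + |v|^2_{F^-1} / 2 = |v + F y|^2_{F^-1} / 2 - |y|^2_F / 2,

    hence the integrand of the cost of v exceeds the integrand of the cost of
    u* = - F y by |v - u*|^2_{F^-1} / 2 ([running_cost_gap]).  Integrating this
    pointwise inequality shows that u* is optimal; if another force has the same
    cost, the nonnegative gap has zero integral, so it vanishes almost surely,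
    and so does v - u* because F^-1 is definite ([cost_min_ae_unique]).

    What remains is that u* is itself a competitor, i.e. a C^1 function with the
    required periodicity ([force_velocity_feedback]).  Its only nontrivial
    ingredient is the smoothness of q |-> M(q)^-1, which follows from Cramer's
    rule: the entries of the inverse are polynomials in the entries of M divided
    by the nonvanishing determinant. *)

(** * Functions of class C^1 *)

Section C1.
Context {R : realType} {U : normedModType R}.
Implicit Types f g : U -> R.

Lemma C1_cst {W : normedModType R} (a : W) : Ck 1 (fun _ : U => a).
Proof.
split=> [x|v] /=; first exact: differentiable_cst.
rewrite (_ : (fun x => 'D_v _ x) = cst 0); first by move=> x; exact: cvg_cst.
by apply/funext => x; exact: derive_cst.
Qed.

Lemma C1_continuous {W : normedModType R} (f : U -> W) : Ck 1 f -> continuous f.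
Proof. by move=> [df _] x; exact/differentiable_continuous/df. Qed.

Lemma C1N {W : normedModType R} (f : U -> W) : Ck 1 f -> Ck 1 (fun x => - f x).
Proof.
move=> [df cf]; split=> [x|v] /=; first exact/differentiableN/df.
rewrite (_ : (fun x => 'D_v _ x) = (fun x => - 'D_v f x)).
  by move=> x; apply: cvgN; exact: cf.
by apply/funext => x; rewrite deriveN//; exact/diff_derivable/df.
Qed.

Lemma C1D f g : Ck 1 f -> Ck 1 g -> Ck 1 (fun x => f x + g x).
Proof.
move=> [df cf] [dg cg]; split=> [x|v] /=.
  exact: (differentiableD (df x) (dg x)).
rewrite (_ : (fun x => 'D_v _ x) = (fun x => 'D_v f x + 'D_v g x)).
  by move=> x; apply: cvgD; [exact: cf|exact: cg].
by apply/funext => x; rewrite deriveD//; exact/diff_derivable.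
Qed.

Lemma C1M f g : Ck 1 f -> Ck 1 g -> Ck 1 (fun x => f x * g x).
Proof.
move=> C1f C1g; have [df cf] := C1f; have [dg cg] := C1g; split=> [x|v] /=.
  exact: (differentiableM (df x) (dg x)).
rewrite (_ : (fun x => 'D_v _ x) = (fun x => f x * 'D_v g x + g x * 'D_v f x)).
  move=> x; apply: cvgD; apply: cvgM.
  - exact: C1_continuous.
  - exact: cg.
  - exact: C1_continuous.
  - exact: cf.
by apply/funext => x; rewrite deriveM//; exact/diff_derivable.
Qed.

Lemma C1V f : (forall x, f x != 0) -> Ck 1 f -> Ck 1 (fun x => (f x)^-1).
Proof.
move=> f0 C1f; have [df cf] := C1f; split=> [x|v] /=.
  exact: (differentiableV (df x) (f0 x)).
rewrite (_ : (fun x => 'D_v _ x) = (fun x => - (f x) ^- 2 * 'D_v f x)).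
  move=> x; apply: cvgM; last exact: cf.
  apply: cvgN; apply: cvgV; first by rewrite expf_neq0.
  by rewrite expr2; apply: cvgM; exact: C1_continuous.
by apply/funext => x; rewrite deriveV//; exact/diff_derivable.
Qed.

Lemma C1_sum (I : Type) (s : seq I) (p : pred I) (F : I -> U -> R) :
  (forall i, Ck 1 (F i)) -> Ck 1 (fun x => \sum_(i <- s | p i) F i x).
Proof.
move=> CF; elim: s => [|i s IH].
  by under eq_fun do rewrite big_nil; exact: C1_cst.
under eq_fun do rewrite big_cons; case: (p i) => //.
exact: C1D.
Qed.

Lemma C1_prod (I : Type) (s : seq I) (p : pred I) (F : I -> U -> R) :
  (forall i, Ck 1 (F i)) -> Ck 1 (fun x => \prod_(i <- s | p i) F i x).
Proof.
move=> CF; elim: s => [|i s IH].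
  by under eq_fun do rewrite big_nil; exact: C1_cst.
under eq_fun do rewrite big_cons; case: (p i) => //.
exact: C1M.
Qed.

Lemma linear_C1 {W : normedModType R} (h : {linear U -> W}) :
  continuous h -> Ck 1 h.
Proof.
move=> ch; split=> [x|v] /=; first exact: linear_differentiable.
rewrite (_ : (fun x => 'D_v _ x) = cst (h v)).
  by move=> x; exact: cvg_cst.
apply/funext => x; rewrite deriveE; last exact: linear_differentiable.
by rewrite diff_lin.
Qed.

Lemma C1_comp_linear {U' W : normedModType R} (h : {linear U' -> U})
    (f : U -> W) :
  continuous h -> Ck 1 f -> Ck 1 (f \o h).
Proof.
move=> ch [df cf]; have dh x : differentiable h x.
  exact: linear_differentiable.
have dfh x : differentiable (f \o h) x.
  by apply: differentiable_comp; [exact: dh|exact: df].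
split=> [//|v] /=.
rewrite (_ : (fun x => 'D_v _ x) = (fun x => 'D_(h v) f (h x))).
  move=> x; apply: (@continuous_comp _ _ _ h ('D_(h v) f)).
    exact: ch.
  exact: cf.
apply/funext => x; rewrite deriveE; last exact: dfh.
rewrite diff_comp; [|exact: dh|exact: df].
by rewrite diff_lin//= deriveE//; exact: df.
Qed.

(** Since every matrix function is handled through its entries, the algebra of
    real-valued C^1 functions is all that products and inverses need. *)
Lemma C1_mxP {m n : nat} (A : U -> 'M[R]_(m, n)) :
  Ck 1 A <-> forall i j, Ck 1 (fun x => A x i j).
Proof.
split=> [[dA cA] i j|CA].
  split=> [x|v] /=.
    apply: (@differentiable_comp _ _ _ _ A (fun B : 'M[R]_(m, n) => B i j)).
      exact: dA.
    exact: differentiable_coord.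
  rewrite (_ : (fun x => 'D_v _ x) = (fun x => ('D_v A x) i j)).
    move=> x.
    apply: (@continuous_comp _ _ _ ('D_v A) (fun B : 'M[R]_(m, n) => B i j)).
      exact: cA.
    exact: coord_continuous.
  by apply/funext => x; rewrite derive_mx ?mxE//; exact/diff_derivable/dA.
have dA x : differentiable A x.
  (* differentiability of A is that of its expansion in the matrix units *)
  rewrite (_ : A =
      \sum_(i < m) \sum_(j < n) (fun x => A x i j *: delta_mx i j)).
    apply: differentiable_sum => i; apply: differentiable_sum => j.
    by apply: differentiableZl; case: (CA i j) => + _; apply.
  apply/funext => y; rewrite {1}(matrix_sum_delta (A y)) fct_sumE.
  by apply: eq_bigr => i _; rewrite fct_sumE.
split=> // v /= x; apply/cvgrPdist_le => /= e e0; near=> y.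
rewrite [leLHS]/Num.Def.normr/= mx_normrE (bigmax_le _ (ltW e0))//= => i _.
rewrite !derive_mx; try exact/diff_derivable.
rewrite !mxE.
move: i; near: y; apply: filter_forall => -[i j] /=.
by have [_ /(_ v x)/cvgrPdist_le/(_ e e0)] := CA i j.
Unshelve. all: by end_near. Qed.

Lemma C1_mulmx {m n p : nat} (A : U -> 'M[R]_(m, n)) (B : U -> 'M[R]_(n, p)) :
  Ck 1 A -> Ck 1 B -> Ck 1 (fun x => A x *m B x).
Proof.
move=> /C1_mxP CA /C1_mxP CB; apply/C1_mxP => i j.
under eq_fun do rewrite mxE.
by apply: C1_sum => k; exact: C1M.
Qed.

Lemma C1_det {n : nat} (A : U -> 'M[R]_n) :
  Ck 1 A -> Ck 1 (fun x => \det (A x)).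
Proof.
move=> /C1_mxP CA; apply: C1_sum => s.
by apply: C1M; [exact: C1_cst|exact: C1_prod].
Qed.

(** By Cramer's rule an entry of the inverse is a cofactor times the inverse of
    the determinant. *)
Lemma C1_invmx {n : nat} (A : U -> 'M[R]_n) :
  (forall x, A x \in unitmx) -> Ck 1 A -> Ck 1 (fun x => invmx (A x)).
Proof.
move=> uA CA; apply/C1_mxP => i j.
under eq_fun do rewrite /invmx uA 2!mxE.
apply: C1M.
  by apply: C1V; [move=> x; rewrite -unitfE; exact: uA|exact: C1_det].
apply: C1M; first exact: C1_cst.
apply: C1_det; apply/C1_mxP => k l.
under eq_fun do rewrite 2!mxE.
by move/C1_mxP: CA; exact.
Qed.

End C1.

(** * Weighted norms *)

Section weighted_norm.
Context {R : realType} {n : nat}.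
Implicit Types (A : 'M[R]_n) (u v : 'cV[R]_n).

Lemma posdef_unitmx A : posdef A -> A \in unitmx.
Proof.
move=> [_ pA]; rewrite unitmxE unitfE; apply/negP => /det0P[v v0 vA].
have : v^T != 0 by apply: contra_neq v0 => vT0; rewrite -[v]trmxK vT0 trmx0.
by move=> /pA; rewrite trmxK vA mul0mx mxE ltxx.
Qed.

Lemma posdef_invmx A : posdef A -> posdef (invmx A).
Proof.
move=> pA; have uA := posdef_unitmx pA; have [sA qA] := pA.
split=> [|v v0]; first by rewrite trmx_inv sA.
have /qA : invmx A *m v != 0.
  by apply: contra_neq v0 => Av0; rewrite -[v](mulKVmx uA) Av0 mulmx0.
by rewrite trmx_mul trmx_inv sA -!mulmxA mulKVmx// mulmxA.
Qed.

Lemma wnorm_sqr A v : posdef A -> wnorm A v ^+ 2 = (v^T *m A *m v) 0 0.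
Proof.
move=> [_ qA]; rewrite sqr_sqrtr//.
have [->|/qA/ltW//] := eqVneq v 0; by rewrite mulmx0 mxE.
Qed.

Lemma wnorm_eq0 A v : posdef A -> wnorm A v = 0 -> v = 0.
Proof.
move=> pA v0; have := wnorm_sqr v pA; rewrite v0 expr0n/= => /esym.
have [//|/(proj2 pA)/[swap] ->] := eqVneq v 0; by rewrite ltxx.
Qed.

Lemma addmx00 (a b : 'M[R]_1) : (a + b) 0 0 = a 0 0 + b 0 0.
Proof. by rewrite mxE. Qed.

Lemma scalar_mx_tr (a : 'M[R]_1) : a^T = a.
Proof. by apply/matrixP => i j; rewrite mxE !ord1. Qed.

(** The two cross terms agree because a number is its own transpose and A is
    symmetric. *)
Lemma wnorm_sqrD A u v : posdef A ->
  wnorm A (u + v) ^+ 2 =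
  wnorm A u ^+ 2 + 2 * (u^T *m A *m v) 0 0 + wnorm A v ^+ 2.
Proof.
move=> pA; rewrite !wnorm_sqr// [(u + v)^T]linearD /=.
rewrite !mulmxDl !mulmxDr !addmx00.
have -> : v^T *m A *m u = u^T *m A *m v.
  by rewrite -[LHS]scalar_mx_tr !trmx_mul trmxK (proj1 pA) mulmxA.
ring.
Qed.

Lemma wnorm_sqrZ A (h : R) u : posdef A ->
  wnorm A (h *: u) ^+ 2 = h ^+ 2 * wnorm A u ^+ 2.
Proof.
move=> pA; rewrite !wnorm_sqr// [(h *: u)^T]linearZ /=.
rewrite -!scalemxAl -scalemxAr 2!mxE.
by rewrite expr2 mulrA.
Qed.

End weighted_norm.

(** * The generator applied to the Hamiltonian *)

(** A function that is quadratic along a line is differentiated by reading off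
    the coefficient of the linear term; the kinetic energy is one, along every
    line in momentum space. *)
Lemma derive_quadratic {R : realType} {U : normedModType R} (f : U -> R)
    (p v : U) (b c : R) :
  (forall h, f (h *: v + p) = f p + h * b + h ^+ 2 * c) -> 'D_v f p = b.
Proof.
move=> fE; apply: cvg_lim => //.
have : (b + h * c) @[h --> 0^'] --> b.
  have /continuous_withinNx : {for 0, continuous (fun h : R => b + h * c)}.
    apply: cvgD; first exact: cvg_cst.
    by apply: cvgM; [exact: cvg_id|exact: cvg_cst].
  by rewrite mul0r addr0.
apply: cvg_trans; apply: near_eq_cvg; near=> h => /=.
have h0 : h != 0 by near: h; exact: nbhs_dnbhs_neq.
by rewrite fE /GRing.scale/=; field.
Unshelve. all: by end_near. Qed.

Section energy_generator.
Context {R : realType} {n : nat}.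
Variables (V : 'cV[R]_n -> R) (M G F : 'cV[R]_n -> 'M[R]_n).
Hypothesis pM : forall q, posdef (M q).
Hypothesis pF : forall q, posdef (F q).
Let H := hamiltonian V M.

Lemma grad_p_hamiltonian x : grad_p H x = velocity M x.
Proof.
have pN := posdef_invmx (pM x.1).
apply/matrixP => i j; rewrite ord1 mxE.
apply: (@derive_quadratic _ _ _ _ _ _
  (2^-1 * wnorm (invmx (M x.1)) (delta_mx i 0) ^+ 2)) => h.
rewrite /H /hamiltonian/= wnorm_sqrD// wnorm_sqrZ//.
rewrite linearZ/= -!scalemxAl mxE -mulmxA trmx_delta -rowE mxE.
by rewrite /velocity; field.
Qed.

(** The two products in the bracket are transposes of each other, hence
    the same number. *)
Lemma poissonxx (phi : phase R n -> R) x : poisson phi phi x = 0.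
Proof.
rewrite /poisson -[X in X - _]scalar_mx_tr trmx_mul trmxK subrr.
by rewrite mxE.
Qed.

(** The force enters only through the power v^T y; the diffusion term is
    common to all forces and drops out when two of them are compared. *)
Lemma generator_hamiltonian v x :
  generator H G v H x =
  ((v x)^T *m velocity M x) 0 0 + 2^-1 * frob (G x.1) (hess_p H x).
Proof. by rewrite /generator poissonxx add0r grad_p_hamiltonian. Qed.

(** The cross term of the square is v^T F^-1 F y = v^T y, the power
    delivered by v. *)
Lemma completed_square v x :
  generator H G v H x + 2^-1 * wnorm (invmx (F x.1)) (v x) ^+ 2 =
  2^-1 * wnorm (invmx (F x.1)) (v x + F x.1 *m velocity M x) ^+ 2
  + (2^-1 * frob (G x.1) (hess_p H x)
     - 2^-1 * wnorm (invmx (F x.1)) (F x.1 *m velocity M x) ^+ 2).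
Proof.
have pN := posdef_invmx (pF x.1).
rewrite generator_hamiltonian wnorm_sqrD// -mulmxA.
by rewrite mulKmx ?posdef_unitmx//; field.
Qed.
End energy_generator.

(** * Velocity feedback *)

Section feedback.
Context {R : realType} {n r : nat}.
Variables (M F : 'cV[R]_n -> 'M[R]_n).
Hypotheses (hM : smooth_spd r M) (hF : smooth_spd r F).

Lemma force_velocity_feedback :
  force r (fun x : phase R n => - (F x.1 *m velocity M x)).
Proof.
have [perM CM pM] := hM; have [perF CF _] := hF.
split=> [p q i i_r /=|]; first by rewrite /velocity /= perM// perF.
have Cfst : continuous (fst : 'cV[R]_n * 'cV[R]_n -> 'cV[R]_n).
  by move=> x; exact: cvg_fst.
have Csnd : continuous (snd : 'cV[R]_n * 'cV[R]_n -> 'cV[R]_n).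
  by move=> x; exact: cvg_snd.
apply/C1N/C1_mulmx; first exact: (C1_comp_linear Cfst (CF 1%N)).
apply: C1_mulmx.
  apply: C1_invmx => [x|]; first exact: posdef_unitmx.
  exact: (C1_comp_linear Cfst (CM 1%N)).
exact: linear_C1.
Qed.
End feedback.

(** * Optimality *)

Section optimality.
Context {R : realType} {n : nat} {d : measure_display}
  {Omega : measurableType d} (P : probability Omega R).
Variables (V : 'cV[R]_n -> R) (M G F : 'cV[R]_n -> 'M[R]_n).
Variable Xt : Omega -> phase R n.
Hypotheses (pM : forall q, posdef (M q)) (pF : forall q, posdef (F q)).

Let ustar (x : phase R n) : 'cV[R]_n := - (F x.1 *m velocity M x).

(** The integrand of the cost, so that two costs can be compared pointwise
    before integrating. *)
Definition running_cost (v : phase R n -> 'cV[R]_n) (w : Omega) : R :=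
  power V M G Xt v w + 2^-1 * effort F Xt v w.

Lemma integrable_running_cost v : finite_expectations P V M G F Xt v ->
  P.-integrable setT (EFin \o running_cost v).
Proof.
move=> [ip ie]; rewrite (_ : EFin \o _ = (fun w =>
    (EFin \o power V M G Xt v) w + (2^-1)%:E * (EFin \o effort F Xt v) w)%E) //.
by apply: integrableD => //; exact: integrableZl.
Qed.

Lemma cost_running_cost v : finite_expectations P V M G F Xt v ->
  cost P V M G F Xt v = (\int[P]_w (running_cost v w)%:E)%E.
Proof.
move=> [ip ie]; rewrite /cost /energy_rate unlock -integralZl//.
by rewrite -integralD//; exact: integrableZl.
Qed.

Lemma running_cost_gap v w :
  running_cost v w - running_cost ustar w =
  2^-1 * wnorm (invmx (F (Xt w).1)) (v (Xt w) - ustar (Xt w)) ^+ 2.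
Proof.
rewrite /running_cost /power /effort !completed_square// /ustar opprK addNr.
have -> : wnorm (invmx (F (Xt w).1)) (0 : 'cV_n) = 0.
  by rewrite /wnorm mulmx0 mxE sqrtr0.
by ring.
Qed.

Lemma running_cost_min v w : running_cost ustar w <= running_cost v w.
Proof. by rewrite -subr_ge0 running_cost_gap mulr_ge0 ?invr_ge0 ?sqr_ge0. Qed.

Lemma cost_min v : finite_expectations P V M G F Xt ustar ->
  finite_expectations P V M G F Xt v ->
  (cost P V M G F Xt ustar <= cost P V M G F Xt v)%E.
Proof.
move=> fs fv; rewrite !cost_running_cost//.
apply: le_integral => //; [exact: integrable_running_cost..|].
by move=> w _; rewrite lee_fin running_cost_min.
Qed.

(** Equal costs force the nonnegative gap of [running_cost_gap] to have zero
    integral, hence to vanish almost surely. *)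
Lemma cost_min_ae_unique v : finite_expectations P V M G F Xt ustar ->
  finite_expectations P V M G F Xt v ->
  (cost P V M G F Xt v <= cost P V M G F Xt ustar)%E ->
  {ae P, forall w, v (Xt w) = ustar (Xt w)}.
Proof.
move=> fs fv v_min; have istar := integrable_running_cost fs.
have iv := integrable_running_cost fv.
pose gap w : \bar R := ((running_cost v w)%:E - (running_cost ustar w)%:E)%E.
have mgap := measurable_int P (integrableB measurableT iv istar).
have : (\int[P]_w `|gap w| = 0)%E.
  under eq_integral => w _.
    rewrite gee0_abs; last first.
      by rewrite /gap -EFinB lee_fin subr_ge0 running_cost_min.
    over.
  rewrite integralB_EFin// -!cost_running_cost//.
  have -> : cost P V M G F Xt v = cost P V M G F Xt ustar.
    by apply/eqP; rewrite eq_le v_min cost_min.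
  by rewrite subee// cost_running_cost// integrable_fin_num.
move/ae_eq_integral_abs => /(_ measurableT mgap); apply: filterS => w /(_ I).
rewrite /gap /= -EFinB running_cost_gap => -[] /eqP.
rewrite mulf_eq0 invr_eq0 pnatr_eq0 sqrf_eq0 /= => /eqP/wnorm_eq0 v0.
by apply/eqP; rewrite -subr_eq0 v0//; exact: posdef_invmx.
Qed.
End optimality.

Theorem lemma2 (R : realType) (n r : nat) (r_le_n : (r <= n)%N)
    (V : 'cV[R]_n -> R) (M G F : 'cV[R]_n -> 'M[R]_n)
    (d : measure_display) (Omega : measurableType d) (P : probability Omega R)
    (FF : R -> set (set Omega)) (W : R -> Omega -> 'cV[R]_n)
    (u : R -> phase R n -> 'cV[R]_n) (X : R -> Omega -> phase R n)
    (hV : smooth_potential r V) (hM : smooth_spd r M) (hG : smooth_spd r G)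
    (hF : smooth_spd r F)
    (hu : forall t, 0 <= t -> force r (u t))
    (hFF : filtration FF) (hW : wiener P FF W)
    (hX : sde_solution P (hamiltonian V M) G u FF W X) :
  let ustar (x : phase R n) : 'cV[R]_n := - (F x.1 *m velocity M x) in
  forall t, 0 <= t ->
    finite_expectations P V M G F (X t) ustar ->
    optimal_force P r V M G F (X t) ustar /\
    forall v, optimal_force P r V M G F (X t) v ->
      {ae P, forall w, v (X t w) = ustar (X t w)}.
Proof.
move=> ustar t _ fs; have [_ _ pM] := hM; have [_ _ pF] := hF.
have adm_star : admissible P r V M G F (X t) ustar.
  by split => //; exact: force_velocity_feedback.
split; first by split=> // v [_ fv]; exact: cost_min.
move=> v [[_ fv] v_min]; apply: (cost_min_ae_unique pM pF fs fv).
exact: v_min.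
Qed.
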